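(* Let $G$ be a group and $\mathcal{F}$ a generating family on $G$. If $G$ is $H$-convex for some $H\in\mathcal{F}$, then each asymptotic cut between two asymptotically disjoint subsets of $G$ (with respect to $\mathcal{E}_{\mathcal{F}}$ and $\lambda_{\mathcal{F}}$) is a large scale separator between them.
   Context: For subsets $A,B$ of a group $G$ put $AB=\{gh\mid g\in A,h\in B\}$ and $A^{-1}=\{g^{-1}\mid g\in A\}$. A generating family (also called generating set) $\mathcal{F}$ on $G$ is a family of subsets of $G$ that contains a nonempty subset of $G$ and such that $A\cup B$, $AB$, $A^{-1}\in\mathcal{F}$ for all $A,B\in\mathcal{F}$. Standing assumption: every generating family satisfies $G=\bigcup_{F\in\mathcal{F}}F$. $G$ is $H$-convex, for $H\in\mathcal{F}$, if $H$ generates $G$ and for each $K\in\mathcal{F}$ there exists $n\in\mathbb{N}$ with $K\subseteq H^n$. $\mathcal{E}_{\mathcal{F}}$ denotes the coarse structure on $G$ consisting of all $E\subseteq G\times G$ such that $E\subseteq\{(ga,gb)\mid g\in G,\ a,b\in F\}$ for some $F\in\mathcal{F}$. For $E\in\mathcal{E}_{\mathcal{F}}$ and $A\subseteq G$, $E(A)=\{y\in G\mid (y,x)\in E\text{ for some }x\in A\}$. For $A,B\subseteq G$ write $A\lambda_{\mathcal{F}}B$ if there exists $K\in\mathcal{F}$ with $A\subseteq BK$ and $B\subseteq AK$. A subset $A\subseteq G$ is bounded if $A=\emptyset$ or $A\lambda_{\mathcal{F}}\{x\}$ for some $x\in G$. Two subsets $A,B$ of $G$ are asymptotically disjoint if whenever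 $L_1\subseteq A$, $L_2\subseteq B$ and $L_1\lambda_{\mathcal{F}}L_2$, then $L_1$ and $L_2$ are bounded. Let $A,B$ be asymptotically disjoint subsets of $G$. For $E\in\mathcal{E}_{\mathcal{F}}$, an $E$-chain from $a$ to $b$ is a finite sequence $a=x_0,\dots,x_n=b$ in $G$ with $(x_i,x_{i+1})\in E$ for all $i\in\{0,\dots,n-1\}$. A subset $C\subseteq G$ is an asymptotic cut between $A$ and $B$ if $C$ is asymptotically disjoint from both $A$ and $B$ and for each $E\in\mathcal{E}_{\mathcal{F}}$ there exists $E'\in\mathcal{E}_{\mathcal{F}}$ such that each $E$-chain from an element of $A$ to an element of $B$ meets $E'(C)$. A subset $C\subseteq G$ is a large scale separator between $A$ and $B$ if $C$ is asymptotically disjoint from both $A$ and $B$ and $G=X_1\cup X_2$ such that $X_1$ and $X_2$ are asymptotically disjoint from $A$ and $B$ respectively, and whenever $L_1\lambda_{\mathcal{F}}L_2$ with $L_1\subseteq X_1$ and $L_2\subseteq X_2$, there is a subset $L$ of $C$ with $L_1\lambda_{\mathcal{F}}L$. *)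

(* Defs.v *)
From mathcomp Require Import all_boot.
From mathcomp Require Import boolp classical_sets.

Set Implicit Arguments.
Unset Strict Implicit.
Unset Printing Implicit Defensive.

Local Open Scope group_scope.
Local Open Scope classical_set_scope.

Definition mulS (G : groupType) (A B : set G) : set G :=
  [set g * h | g in A & h in B].

Definition invS (G : groupType) (A : set G) : set G := [set g^-1 | g in A].

(* Products of n elements of A; the zeroth power is [set 1]. *)
Definition expS (G : groupType) (A : set G) (n : nat) : set G :=
  iter n (mulS A) [set 1].

(* The last field is part of the standing assumptions on generating
   families. *)
Record generating_family (G : groupType) (F : set (set G)) : Prop := {
  gf_nonempty : exists2 A, F A & A !=set0;
  gf_setU : forall A B, F A -> F B -> F (A `|` B);
  gf_mulS : forall A B, F A -> F B -> F (mulS A B);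
  gf_invS : forall A, F A -> F (invS A);
  gf_cover : \bigcup_(A in F) A = setT
}.

Definition generated_subgroup (G : groupType) (A : set G) : set G :=
  smallest [set S | group_closed [in S]] A.

Definition convex_group (G : groupType) (F : set (set G)) (H : set G) : Prop :=
  generated_subgroup H = setT /\
  (forall K, F K -> exists n, K `<=` expS H n).

Definition coarse_structure (G : groupType) (F : set (set G)) :
    set (set (G * G)) :=
  [set E | exists2 A, F A &
    E `<=` [set p | exists g, exists2 a, A a & exists2 b, A b &
                    p = (g * a, g * b)]].

(* E(A), with A fed to the second coordinate of E. *)
Definition section (T : Type) (E : set (T * T)) (A : set T) : set T :=
  [set y | exists2 x, A x & E (y, x)].

(* The relation lambda_F. *)
Definition ls_rel (G : groupType) (F : set (set G)) (A B : set G) : Prop :=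
  exists2 K, F K & A `<=` mulS B K /\ B `<=` mulS A K.

Definition ls_bounded (G : groupType) (F : set (set G)) (A : set G) : Prop :=
  A = set0 \/ exists x, ls_rel F A [set x].

Definition asymptotically_disjoint (G : groupType) (F : set (set G))
    (A B : set G) : Prop :=
  forall L1 L2, L1 `<=` A -> L2 `<=` B -> ls_rel F L1 L2 ->
    ls_bounded F L1 /\ ls_bounded F L2.

(* The chain x_0, ..., x_n is the nonempty sequence a :: s, so n = size s. *)
Definition is_chain (T : eqType) (E : set (T * T)) (a : T) (s : seq T) (b : T) :
    Prop :=
  path (fun x y => (x, y) \in E) a s /\ last a s = b.

Definition asymptotic_cut (G : groupType) (F : set (set G)) (A B C : set G) :
    Prop :=
  [/\ asymptotically_disjoint F C A,
      asymptotically_disjoint F C B &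
      forall E, coarse_structure F E ->
        exists2 E', coarse_structure F E' &
          forall a b s, A a -> B b -> is_chain E a s b ->
            exists2 x, x \in a :: s & section E' C x].

Definition large_scale_separator (G : groupType) (F : set (set G))
    (A B C : set G) : Prop :=
  [/\ asymptotically_disjoint F C A,
      asymptotically_disjoint F C B &
      exists X1 X2 : set G,
        [/\ X1 `|` X2 = setT,
            asymptotically_disjoint F X1 A,
            asymptotically_disjoint F X2 B &
            forall L1 L2, L1 `<=` X1 -> L2 `<=` X2 -> ls_rel F L1 L2 ->
              exists2 L, L `<=` C & ls_rel F L1 L]].

(* Main.v *)
Require Import Defs.
From mathcomp Require Import all_boot.
From mathcomp Require Import boolp classical_sets.

(** Fix a step set M in F containing H and 1, and let D = E'(C) be the
    coarse neighbourhood of C which, by the cut property, meets every M-chain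
    from A to B. Let U be the set of points reached from A by M-chains avoiding
    D, and take X1 = G \ U and X2 = U `|` D. Then A lies in X2 and, by the cut
    property, B lies in X1. By convexity a bounded displacement is a product of
    boundedly many elements of H, and such a path from X2 to X1 must cross D:
    points of X1 close to X2 are therefore close to C. This is the separation
    property, and applied to subsets of A and of B it also reduces the two
    asymptotic disjointness claims to those assumed for C. *)

Set Implicit Arguments.
Unset Strict Implicit.
Unset Printing Implicit Defensive.

Local Open Scope group_scope.
Local Open Scope classical_set_scope.

Section LargeScaleRelation.
Variables (G : groupType) (F : set (set G)).
Hypothesis gfF : generating_family F.

Lemma mulSA (A B C : set G) : mulS A (mulS B C) = mulS (mulS A B) C.
Proof.
apply/seteqP; split=> x.
- move=> [a Aa [_ [b Bb [c Cc <-]] <-]].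
  by exists (a * b); [exists a => //; exists b | exists c => //; rewrite mulgA].
- move=> [_ [a Aa [b Bb <-]] [c Cc <-]].
  by exists a => //; exists (b * c); [exists b => //; exists c | rewrite mulgA].
Qed.

Lemma mulSS (A A' B B' : set G) :
  A `<=` A' -> B `<=` B' -> mulS A B `<=` mulS A' B'.
Proof.
by move=> sA sB _ [a Aa [b Bb <-]]; exists a; [exact: sA | exists b; [exact: sB|]].
Qed.

Lemma gf_one : exists2 K, F K & K 1.
Proof.
have : (\bigcup_(A in F) A) (1 : G) by rewrite (gf_cover gfF).
by move=> [K FK K1]; exists K.
Qed.

Lemma expS_sub_gf (M : set G) n : F M -> exists2 K, F K & expS M n `<=` K.
Proof.
move=> FM; elim: n => [|n [K FK sK]].
  by have [K FK K1] := gf_one; exists K => // _ ->.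
by exists (mulS M K); [exact: (gf_mulS gfF) | exact: mulSS].
Qed.

Lemma ls_rel_sym (A B : set G) : ls_rel F A B -> ls_rel F B A.
Proof. by move=> [K FK [? ?]]; exists K. Qed.

Lemma ls_rel_trans (A B C : set G) :
  ls_rel F A B -> ls_rel F B C -> ls_rel F A C.
Proof.
move=> [K FK [AB BA]] [K' FK' [BC CB]].
(* [A] lies in [C K' K] while [C] lies in [A K K']; the two products may differ in a noncommutative
   group. *)
exists (mulS K' K `|` mulS K K').
  by apply: (gf_setU gfF); exact: (gf_mulS gfF).
split.
- apply: (subset_trans AB); apply: (@subset_trans _ (mulS C (mulS K' K))).
    by rewrite mulSA; exact: mulSS.
  by apply: mulSS => // x ?; left.
- apply: (subset_trans CB); apply: (@subset_trans _ (mulS A (mulS K K'))).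
    by rewrite mulSA; exact: mulSS.
  by apply: mulSS => // x ?; right.
Qed.

Lemma ls_bounded_rel (A B : set G) :
  ls_rel F A B -> ls_bounded F A -> ls_bounded F B.
Proof.
move=> AB [A0|[x Ax]]; last first.
  by right; exists x; apply: ls_rel_trans Ax; exact: ls_rel_sym.
left; move: AB => [K _ [_ BA]]; rewrite -subset0 => b /BA [a Aa _].
by rewrite A0 in Aa.
Qed.

(** Keeping only the points of [C] that some element of [K] carries into [L] makes the one-sided
    inclusion two-sided. *)
Lemma ls_rel_subset_mulS (L C K : set G) :
  F K -> L `<=` mulS C K -> exists2 L', L' `<=` C & ls_rel F L L'.
Proof.
move=> FK LCK; exists (C `&` mulS L (invS K)); first by move=> x [].
exists (K `|` invS K).
  by apply: (gf_setU gfF) => //; exact: (gf_invS gfF).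
split; last by move=> x [_]; apply: mulSS => // y; right.
move=> x Lx; have [c Cc [k Kk ckx]] := LCK x Lx.
exists c; last by exists k => //; left.
split=> //; exists x => //; exists k^-1; first by exists k.
by rewrite -ckx mulgK.
Qed.

(** Multiplying [x] by the factors of [k] one at a time leaves [U] only through [D]; the factors
    after a visit to [D] give the displacement from [D]. *)
Lemma expS_crossing (H M U D : set G) (x k : G) n :
  H `<=` M -> M 1 ->
  (forall y h, U y -> H h -> ~ D (y * h) -> U (y * h)) ->
  (U `|` D) x -> expS H n k -> ~ U (x * k) -> mulS D (expS M n) (x * k).
Proof.
move=> sHM M1 stepU.
have sHMn m : expS H m `<=` expS M m by elim: m => //= m; exact: mulSS.
move=> [Ux|Dx] Hk nU; last first.
  by exists x => //; exists k => //; exact: sHMn.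
elim: n x k Ux Hk nU => [|n IHn] x k Ux.
  by move=> ->; rewrite mulg1.
move=> [h Hh [k' Hk' <-]]; rewrite mulgA => nU.
suff [d Dd [q Mq <-]] : mulS D (expS M n) (x * h * k').
  by exists d => //; exists q => //; exists 1 => //; exists q; rewrite ?mul1g.
have [Dxh|nDxh] := pselect (D (x * h)).
  by exists (x * h) => //; exists k' => //; exact: sHMn.
by apply: IHn => //; exact: stepU.
Qed.

Lemma section_sub_mulS (E : set (G * G)) (C : set G) :
  coarse_structure F E -> exists2 K, F K & section E C `<=` mulS C K.
Proof.
move=> [N FN sE]; exists (mulS (invS N) N).
  by apply: (gf_mulS gfF) => //; exact: (gf_invS gfF).
move=> y [x Cx /sE [g [a Na [b Nb [-> xE]]]]].
(* From [y = g * a] and [x = g * b] follows [y = x * (b^-1 * a)]. *)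
exists x => //; exists (b^-1 * a).
  by exists b^-1; [exists b | exists a].
by rewrite xE mulgA mulgK.
Qed.

End LargeScaleRelation.

(** The starting point must avoid [D] too, so points of [A] in [D] are left out. *)
Definition avoiding_component (T : eqType) (E : set (T * T)) (A D : set T) :
    set T :=
  [set x | exists a s, [/\ A a, is_chain E a s x &
                           forall y, y \in a :: s -> ~ D y]].

Lemma avoiding_component_step (T : eqType) (E : set (T * T)) (A D : set T)
    (x y : T) :
  avoiding_component E A D x -> E (x, y) -> ~ D y -> avoiding_component E A D y.
Proof.
move=> [a [s [Aa [pas las] avD]]] Exy nDy; exists a, (rcons s y).
split=> //.
  by split; [rewrite rcons_path pas las; apply/mem_set | rewrite last_rcons].
by move=> z; rewrite -rcons_cons mem_rcons inE => /orP[/eqP->|/avD].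
Qed.

Theorem proposition4p14 (G : groupType) (F : set (set G)) (H : set G)
    (gfF : generating_family F) (FH : F H) (cvxH : convex_group F H)
    (A B C : set G) (AB : asymptotically_disjoint F A B) :
  asymptotic_cut F A B C -> large_scale_separator F A B C.
Proof.
move=> [CA CB cutC]; split=> //.
have [K0 FK0 K01] := gf_one gfF.
(* With [1] in [M], each step from [y] to [y * h] with [h] in [H] is the pair [(y * 1, y * h)] of
   [E]. *)
pose M := H `|` K0.
have FM : F M by exact: (gf_setU gfF).
pose E : set (G * G) := [set p | exists g, exists2 a, M a & exists2 b, M b &
  p = (g * a, g * b)].
have [E' cE' meetE'] : exists2 E', coarse_structure F E' &
    forall a b s, A a -> B b -> is_chain E a s b ->
    exists2 x, x \in a :: s & section E' C x.
  by apply: cutC; exists M.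
pose D := section E' C.
have [N FN sDN] : exists2 N, F N & D `<=` mulS C N by exact: section_sub_mulS.
pose U := avoiding_component E A D.
have stepU y h : U y -> H h -> ~ D (y * h) -> U (y * h).
  move=> Uy Hh; apply: avoiding_component_step Uy _.
  by exists y, 1; [right | exists h; [left | rewrite mulg1]].
have sAX : A `<=` U `|` D.
  move=> a Aa; have [Da|nDa] := pselect (D a); first by right.
  by left; exists a, [::]; split=> // y; rewrite inE => /eqP->.
have sBX : B `<=` ~` U.
  move=> b Bb [a [s [Aa chain avD]]].
  by have [x /avD] := meetE' _ _ _ Aa Bb chain.
have sep L1 L2 : L1 `<=` ~` U -> L2 `<=` U `|` D -> ls_rel F L1 L2 ->
    exists2 L, L `<=` C & ls_rel F L1 L.
  move=> L1X L2X [K FK [L12 _]].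
  have [n sKH] := cvxH.2 K FK.
  have [P FP sMP] := expS_sub_gf gfF n FM.
  apply: (ls_rel_subset_mulS gfF (gf_mulS gfF FN FP)).
  move=> x L1x; have [y L2y [k Kk xE]] := L12 x L1x.
  have : mulS D (expS M n) (y * k).
    apply: (expS_crossing _ _ stepU (L2X y L2y) (sKH k Kk)).
    - by move=> z; left.
    - by right.
    - by rewrite xE; exact: L1X.
  by rewrite xE mulSA; exact: mulSS.
exists (~` U), (U `|` D); split=> //.
- by rewrite setUA setvU setTU.
- move=> L1 L2 L1X L2A L12.
  (* [L] is close to [L1], hence to [L2]; disjointness of [C] and [A] bounds [L] and [L2], and [L1]
     inherits the bound from [L]. *)
  have [L LC L1L] := sep _ _ L1X (subset_trans L2A sAX) L12.
  have [bL bL2] := CA _ _ LC L2A (ls_rel_trans gfF (ls_rel_sym L1L) L12).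
  by split=> //; apply: (ls_bounded_rel gfF) bL; exact: ls_rel_sym.
- move=> L1 L2 L1X L2B L12.
  (* Here [L2], a part of [B], is the set outside [U], so the roles in [sep] are exchanged. *)
  have [L LC L2L] := sep _ _ (subset_trans L2B sBX) L1X (ls_rel_sym L12).
  have [_ bL2] := CB _ _ LC L2B (ls_rel_sym L2L).
  by split=> //; apply: (ls_bounded_rel gfF) bL2; exact: ls_rel_sym.
Qed.
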